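(* Let $n\ge 1$. The excedance congruence, i.e. the equivalence relation $\equiv$ on $\mathbf{HFM}_n$ defined by $H\equiv H'$ if and only if $H_{i,j}=H'_{i,j}$ for all $0\le i,j\le n$ with $j-i\in\{0,1\}$, is a lattice congruence of $\mathbf{HFM}_n$ (equivalently, the corresponding equivalence relation on $\mathbf{ASM}_n$ is a lattice congruence of $\mathbf{ASM}_n$).
   Context: A height function matrix (HFM) of order $n$ is an $(n+1)\times(n+1)$ matrix $H=(H_{i,j})_{0\le i,j\le n}$ whose first row and first column consist of the numbers $0,1,\dots,n$ in increasing order, whose last row and last column consist of the numbers $n,n-1,\dots,0$ in decreasing order, and such that any two consecutive entries in a row or a column differ by $1$ in absolute value. $\mathbf{HFM}_n$ is the set of HFMs of order $n$ ordered by entrywise comparison; it is a distributive lattice where join and meet are entrywise maximum and minimum. An alternating sign matrix (ASM) of order $n$ is an $n\times n$ matrix $A$ with entries in $\{-1,0,1\}$, all row and column sums $1$, and whose nonzero entries alternate in sign in each row and column. The map $A\mapsto H$ with $H_{i,j}=i+j-2\sum_{i'\le i,\,j'\le j}A_{i',j'}$ is a bijection from ASMs to HFMs of order $n$; $\mathbf{ASM}_n$ is the lattice on ASMs obtained by transporting the order of $\mathbf{HFM}_n$ along this bijection. A congruence of a lattice is an equivalence relation $\equiv$ such that $x\equiv x'$ and $y\equiv y'$ imply $x\vee y\equiv x'\vee y'$ and $x\wedge y\equiv x'\wedge y'$. *)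

(* Defs.v *)
From HB Require Import structures.
From mathcomp Require Import all_boot all_order all_algebra.
From mathcomp Require Import zify.
Set Implicit Arguments.
Unset Strict Implicit.
Unset Printing Implicit Defensive.
Import Order.TTheory GRing.Theory Num.Theory.
Local Open Scope ring_scope.

(* The row half of the definition; the column half is the same condition on
   the transpose. *)
Definition hfm_rows n (H : 'M[int]_n.+1) : bool :=
  [&& [forall j, H ord0 j == j%:Z],
      [forall j, H ord_max j == n%:Z - j%:Z]
    & [forall i, forall j : 'I_n.+1, forall j' : 'I_n.+1,
        (j' == j.+1 :> nat) ==> (`|H i j' - H i j| == 1)]].

Definition is_hfm n (H : 'M[int]_n.+1) : bool := hfm_rows H && hfm_rows H^T.

Record HFM n := MkHFM { hfm_mx :> 'M[int]_n.+1; _ : is_hfm hfm_mx }.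

HB.instance Definition _ n := [isSub for @hfm_mx n].
HB.instance Definition _ n := [Choice of HFM n by <:].

Definition asm_rows n (A : 'M[int]_n) : bool :=
  [&& [forall i, forall j, A i j \in [:: -1; 0; 1]],
      [forall i, \sum_j A i j == 1]
    & [forall i, forall j : 'I_n, forall k : 'I_n,
        [&& (j < k)%N, A i j != 0, A i k != 0
          & [forall l : 'I_n, (j < l < k)%N ==> (A i l == 0)]]
        ==> (A i k == - A i j)]].

Definition is_asm n (A : 'M[int]_n) : bool := asm_rows A && asm_rows A^T.

Record ASM n := MkASM { asm_mx :> 'M[int]_n; _ : is_asm asm_mx }.

HB.instance Definition _ n := [isSub for @asm_mx n].
HB.instance Definition _ n := [Choice of ASM n by <:].

(* Rows and columns of ASMs are indexed from 0 here, hence the strict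
   inequalities in the corner sum. *)
Definition hfm_of_mx n (A : 'M[int]_n) : 'M[int]_n.+1 :=
  \matrix_(i, j) (i%:Z + j%:Z
    - 2 * \sum_(k < n | (k < i)%N) \sum_(l < n | (l < j)%N) A k l).

(* The inverse map; the numerator is even when H is an HFM. *)
Definition asm_of_mx n (H : 'M[int]_n.+1) : 'M[int]_n :=
  let lo := widen_ord (leqnSn n) in let hi := lift ord0 in
  \matrix_(k, l) ((H (lo k) (hi l) + H (hi k) (lo l)
                   - H (lo k) (lo l) - H (hi k) (hi l)) %/ 2)%Z.

Definition lattice_congruence d (L : latticeType d) (R : rel L) : Prop :=
  equivalence_rel R /\
  forall x x' y y' : L, R x x' -> R y y' ->
    R (x `|` y)%O (x' `|` y')%O /\ R (x `&` y)%O (x' `&` y')%O.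

Section HFMTheory.
Variable n : nat.
Implicit Types H K : 'M[int]_n.+1.

Lemma hfm_rowsP H : reflect
  [/\ forall j, H ord0 j = j%:Z, forall j, H ord_max j = n%:Z - j%:Z
    & forall (i j j' : 'I_n.+1), j' = j.+1 :> nat -> `|H i j' - H i j| = 1]
  (hfm_rows H).
Proof.
apply: (iffP and3P) => [[/forallP h1 /forallP h2 /forallP h3]|[h1 h2 h3]].
  split=> [j|j|i j j' /eqP e]; [exact/eqP|exact/eqP|].
  by have /forallP/(_ j)/forallP/(_ j')/implyP/(_ e)/eqP := h3 i.
split; [by apply/forallP=> j; apply/eqP|by apply/forallP=> j; apply/eqP|].
apply/forallP=> i; apply/forallP=> j; apply/forallP=> j'; apply/implyP=> /eqP e.
by apply/eqP/h3.
Qed.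

Lemma is_hfm_tr H : is_hfm H^T = is_hfm H.
Proof. by rewrite /is_hfm trmxK andbC. Qed.

Lemma hfm_parity H : is_hfm H ->
  forall i j, exists c : int, H i j = (i : nat)%:Z + (j : nat)%:Z + 2 * c.
Proof.
move=> /andP[/hfm_rowsP[_ _ st] /hfm_rowsP[c0 _ _]] i [j lt_j].
elim: j lt_j => [|j IHj] lt_j.
  exists 0; have := c0 i; rewrite mxE.
  by rewrite (_ : Ordinal lt_j = ord0) /=; [lia | exact: val_inj].
have lt_j' : (j < n.+1)%N by lia.
have [c ec] := IHj lt_j'.
have := st i (Ordinal lt_j') (Ordinal lt_j) erefl; rewrite ec /= => s.
case: (leP 0 (H i (Ordinal lt_j) - (i%:Z + j%:Z + 2 * c))) => s'.
  by exists c; lia.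
by exists (c - 1); lia.
Qed.

Definition max_mx H K : 'M[int]_n.+1 := \matrix_(i, j) Num.max (H i j) (K i j).
Definition min_mx H K : 'M[int]_n.+1 := \matrix_(i, j) Num.min (H i j) (K i j).

Lemma max_mx_tr H K : (max_mx H K)^T = max_mx H^T K^T.
Proof. by apply/matrixP=> i j; rewrite !mxE. Qed.
Lemma min_mx_tr H K : (min_mx H K)^T = min_mx H^T K^T.
Proof. by apply/matrixP=> i j; rewrite !mxE. Qed.

Lemma max_mx_rows H K : is_hfm H -> is_hfm K -> hfm_rows (max_mx H K).
Proof.
move=> hH hK; have pH := hfm_parity hH; have pK := hfm_parity hK.
case/andP: hH => /hfm_rowsP[a1 a2 a3] _; case/andP: hK => /hfm_rowsP[b1 b2 b3] _.
apply/hfm_rowsP; split=> [j|j|i j j' e]; rewrite !mxE.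
- by rewrite a1 b1 maxxx.
- by rewrite a2 b2 maxxx.
have := a3 i j j' e; have := b3 i j j' e.
have [c ->] := pH i j; have [c' ->] := pH i j'.
have [d ->] := pK i j; have [d' ->] := pK i j'.
by rewrite e; lia.
Qed.

Lemma min_mx_rows H K : is_hfm H -> is_hfm K -> hfm_rows (min_mx H K).
Proof.
move=> hH hK; have pH := hfm_parity hH; have pK := hfm_parity hK.
case/andP: hH => /hfm_rowsP[a1 a2 a3] _; case/andP: hK => /hfm_rowsP[b1 b2 b3] _.
apply/hfm_rowsP; split=> [j|j|i j j' e]; rewrite !mxE.
- by rewrite a1 b1 minxx.
- by rewrite a2 b2 minxx.
have := a3 i j j' e; have := b3 i j j' e.
have [c ->] := pH i j; have [c' ->] := pH i j'.
have [d ->] := pK i j; have [d' ->] := pK i j'.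
by rewrite e; lia.
Qed.

Lemma max_mx_hfm (H K : HFM n) : is_hfm (max_mx H K).
Proof.
rewrite /is_hfm max_mx_tr !max_mx_rows ?is_hfm_tr //; exact: valP.
Qed.
Lemma min_mx_hfm (H K : HFM n) : is_hfm (min_mx H K).
Proof.
rewrite /is_hfm min_mx_tr !min_mx_rows ?is_hfm_tr //; exact: valP.
Qed.

Definition hfm_le (H K : HFM n) : bool :=
  [forall i, forall j, H i j <= K i j].
Definition hfm_join (H K : HFM n) : HFM n := MkHFM (max_mx_hfm H K).
Definition hfm_meet (H K : HFM n) : HFM n := MkHFM (min_mx_hfm H K).

Lemma hfm_leP (H K : HFM n) :
  reflect (forall i j, H i j <= K i j) (hfm_le H K).
Proof.
apply: (iffP forallP) => h i; first by move=> j; have /forallP := h i.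
by apply/forallP=> j; apply: h.
Qed.

Lemma hfm_le_refl : reflexive hfm_le.
Proof. by move=> H; apply/hfm_leP. Qed.

Lemma hfm_le_anti : antisymmetric hfm_le.
Proof.
move=> H K /andP[/hfm_leP h /hfm_leP k]; apply/val_inj/matrixP=> i j.
by apply/le_anti; rewrite h k.
Qed.

Lemma hfm_le_trans : transitive hfm_le.
Proof.
move=> K H G /hfm_leP h /hfm_leP k; apply/hfm_leP=> i j.
exact: le_trans (h i j) (k i j).
Qed.

Lemma hfm_meetP (x y z : HFM n) :
  hfm_le x (hfm_meet y z) = hfm_le x y && hfm_le x z.
Proof.
apply/hfm_leP/andP => [h|[/hfm_leP h /hfm_leP k] i j].
  by split; apply/hfm_leP=> i j; have := h i j; rewrite mxE le_min => /andP[].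
by rewrite mxE le_min h k.
Qed.

Lemma hfm_joinP (x y z : HFM n) :
  hfm_le (hfm_join x y) z = hfm_le x z && hfm_le y z.
Proof.
apply/hfm_leP/andP => [h|[/hfm_leP h /hfm_leP k] i j].
  by split; apply/hfm_leP=> i j; have := h i j; rewrite mxE ge_max => /andP[].
by rewrite mxE ge_max h k.
Qed.

Lemma hfm_meetUl : left_distributive hfm_meet hfm_join.
Proof.
by move=> x y z; apply/val_inj/matrixP=> i j; rewrite !mxE min_maxl.
Qed.

End HFMTheory.

Fact hfm_display : Order.disp_t. Proof. exact: Order.Disp tt tt. Qed.
HB.instance Definition _ n := Order.Le_isPOrder.Build hfm_display (HFM n)
  (@hfm_le_refl n) (@hfm_le_anti n) (@hfm_le_trans n).
HB.instance Definition _ n :=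
  Order.POrder_MeetJoin_isLattice.Build hfm_display (HFM n)
    (@hfm_meetP n) (@hfm_joinP n).
HB.instance Definition _ n :=
  Order.Lattice_Meet_isDistrLattice.Build hfm_display (HFM n) (@hfm_meetUl n).

Section Bijection.
Variable n : nat.
Implicit Types (A : 'M[int]_n) (H : 'M[int]_n.+1).

Definition row_prefix A (i : 'I_n) (m : nat) : int :=
  \sum_(l < n | (l < m)%N) A i l.

Lemma row_prefix0 A i : row_prefix A i 0 = 0.
Proof. by rewrite /row_prefix big_pred0. Qed.

Lemma row_prefixn A i : row_prefix A i n = \sum_l A i l.
Proof. by apply: eq_bigl => l; rewrite ltn_ord. Qed.

Lemma row_prefixS A i (j : 'I_n) : row_prefix A i j.+1 = row_prefix A i j + A i j.
Proof.
rewrite /row_prefix (bigD1 j) /= ?ltnSn // addrC; congr (_ + _).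
by apply: eq_bigl => l; rewrite -val_eqE /=; lia.
Qed.

Lemma asm_rowsP A : reflect
  [/\ forall i j, A i j \in [:: -1; 0; 1], forall i, \sum_j A i j = 1
    & forall i (j k : 'I_n), (j < k)%N -> A i j != 0 -> A i k != 0 ->
        (forall l : 'I_n, (j < l < k)%N -> A i l = 0) -> A i k = - A i j]
  (asm_rows A).
Proof.
apply: (iffP and3P) => [[/forallP h1 /forallP h2 /forallP h3]|[h1 h2 h3]].
  split=> [i j|i|i j k jk nj nk z]; [exact: (forallP (h1 i) j)|exact/eqP|].
  have /forallP/(_ j)/forallP/(_ k)/implyP h := h3 i; apply/eqP/h.
  by rewrite jk nj nk; apply/forallP=> l; apply/implyP=> /z/eqP.
split; [by apply/forallP=> i; apply/forallP=> j|by apply/forallP=> i; apply/eqP|].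
apply/forallP=> i; apply/forallP=> j; apply/forallP=> k.
apply/implyP=> /and4P[jk nj nk /forallP z]; apply/eqP/h3=> // l jl.
by apply/eqP; have /implyP/(_ jl) := z l.
Qed.

(* c is the sign of the first nonzero entry of the row. *)
Lemma asm_row_prefix A i m : asm_rows A -> (m <= n)%N ->
  row_prefix A i m = 0 \/ row_prefix A i m = 1.
Proof.
move=> /asm_rowsP[ent tot alt].
pose inv c m := ((forall k : 'I_n, (k < m)%N -> A i k = 0) /\ row_prefix A i m = 0)
  \/ exists p : 'I_n, [/\ (p < m)%N, forall k : 'I_n, (p < k < m)%N -> A i k = 0
     & (A i p = c /\ row_prefix A i m = c) \/ (A i p = - c /\ row_prefix A i m = 0)].
have [c [hc Hinv]] : exists c : int, (c = 1 \/ c = -1) /\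
    forall m, (m <= n)%N -> inv c m.
  have [c [hc first]] : exists c : int, (c = 1 \/ c = -1) /\
      forall q : 'I_n, (forall k : 'I_n, (k < q)%N -> A i k = 0) ->
        A i q <> 0 -> A i q = c.
    case: (pickP (fun q => A i q != 0)) => [q0 nq0|all0]; last first.
      exists 1; split; first by left.
      by move=> q _ /eqP; have := all0 q => /= ->.
    case: (@arg_minnP _ q0 (fun q => A i q != 0) (fun q => val q) nq0) => q nq qmin.
    exists (A i q); split.
      by move: nq (ent i q); rewrite !inE => /negPf->; case/orP=> /eqP; auto.
    move=> p zp /eqP np; congr (A i _); apply/val_inj/eqP.
    rewrite eqn_leq (qmin p) // andbT leqNgt; apply/negP=> lt.
    by have := zp q lt => /eqP; rewrite (negPf nq).
  exists c; split=> //; elim=> [_|k IHk lek].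
    by left; split; [|exact: row_prefix0].
  pose o := Ordinal lek.
  have rS : row_prefix A i k.+1 = row_prefix A i k + A i o.
    exact: (row_prefixS A i o).
  have lt_o (l : 'I_n) : (l < k.+1)%N -> (l < k)%N \/ l = o.
    rewrite ltnS leq_eqVlt => /orP[/eqP e|]; [right|by left].
    exact: val_inj.
  case: (eqVneq (A i o) 0) => [z|nz].
    case: (IHk (ltnW lek)) => [[z0 s0]|[p [pk z0 s0]]].
      left; rewrite rS s0 z; split=> // l /lt_o[/z0|->] //.
    right; exists p; split; first exact: ltnW.
      by move=> l /andP[pl /lt_o[lk|->] //]; apply: z0; rewrite pl.
    by rewrite rS z addr0.
  case: (IHk (ltnW lek)) => [[z0 s0]|[p [pk z0 s0]]]; right; exists o.
    have e := first o z0 (elimN eqP nz).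
    split; [exact: ltnSn|by move=> l /=; lia|].
    by left; rewrite rS s0 e add0r.
  have np : A i p != 0.
    by case: s0 => -[-> _]; rewrite ?oppr_eq0; case: hc => ->.
  have e := alt i p o pk np nz z0.
  split; [exact: ltnSn|by move=> l /=; lia|].
  by rewrite rS e; case: s0 => -[-> ->]; [right|left]; rewrite ?opprK; lia.
have c1 : (forall k, A i k = 0) \/ c = 1.
  have := Hinv n (leqnn n); rewrite /inv row_prefixn tot.
  case=> [[_ //]|[p [_ _ s]]]; right; by case: s => -[_].
move=> /Hinv; case: c1 => [z|->].
  by left; rewrite /row_prefix big1.
by case=> [[_ ->]|[p [_ _ s]]]; [left|case: s => -[_ ->]; [right|left]].
Qed.

Lemma asm_rows_of_prefix A :
  (forall i m, (m <= n)%N -> row_prefix A i m = 0 \/ row_prefix A i m = 1) ->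
  (forall i, row_prefix A i n = 1) -> asm_rows A.
Proof.
move=> h tot; apply/asm_rowsP; split=> [i j|i|i j k jk nj nk z].
- have := row_prefixS A i j.
  have := h i j (ltnW (ltn_ord j)); have := h i j.+1 (ltn_ord j).
  by rewrite !inE; lia.
- by rewrite -row_prefixn.
have e : row_prefix A i k = row_prefix A i j.+1.
  rewrite /row_prefix [LHS](bigID (fun l : 'I_n => (l < j.+1)%N)) /=.
  rewrite [X in _ + X]big1 ?addr0 => [|l]; last by move=> h'; apply: z; lia.
  by apply: eq_bigl => l; lia.
have := row_prefixS A i j; have := row_prefixS A i k; rewrite e.
have := h i j (ltnW (ltn_ord j)); have := h i j.+1 (ltn_ord j).
have := h i k.+1 (ltn_ord k); move: nj nk => /eqP nj /eqP nk; lia.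
Qed.

Lemma hfm_of_mx_tr A : (hfm_of_mx A)^T = hfm_of_mx A^T.
Proof.
apply/matrixP=> i j; rewrite !mxE exchange_big /= [X in X - _]addrC; congr (_ - _ * _).
apply: eq_bigr => k _; apply: eq_bigr => l _.
by rewrite mxE.
Qed.

Lemma asm_of_mx_tr H : (asm_of_mx H)^T = asm_of_mx H^T.
Proof.
by apply/matrixP=> i j; rewrite !mxE [X in (X - _ - _)%R]addrC.
Qed.

Lemma hfm_of_mx_step A (i j' : 'I_n.+1) (j : 'I_n) (jj : 'I_n.+1) :
  jj = j :> nat -> j' = j.+1 :> nat ->
  hfm_of_mx A i j' - hfm_of_mx A i jj = 1 - 2 * row_prefix A^T j i.
Proof.
move=> e e'; rewrite !mxE e e'.
have -> : \sum_(k < n | (k < i)%N) \sum_(l < n | (l < j.+1)%N) A k l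
  = \sum_(k < n | (k < i)%N) \sum_(l < n | (l < j)%N) A k l + row_prefix A^T j i.
  rewrite /row_prefix -big_split /=; apply: eq_bigr => k _.
  by rewrite mxE; exact: row_prefixS.
have aux (x y s r : int) : x + (y + 1) - 2 * (s + r) - (x + y - 2 * s) = 1 - 2 * r.
  by lia.
by rewrite -[j.+1]addn1 PoszD; exact: aux.
Qed.

Lemma hfm_of_mx_rows A : is_asm A -> hfm_rows (hfm_of_mx A).
Proof.
move=> /andP[rA cA]; apply/hfm_rowsP; split=> [j|j|i j j' e].
- by rewrite mxE big_pred0 // mulr0 subr0 add0r.
- rewrite mxE exchange_big /=.
  rewrite (eq_bigr (fun=> 1)) => [|l _]; last first.
    have /asm_rowsP[_ tot _] := cA; rewrite -(tot l).
    by apply: eq_big => k; rewrite ?ltn_ord ?mxE.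
  rewrite -(big_ord_widen _ (fun=> 1)) ?sumr_const ?card_ord; last first.
    by have := ltn_ord j; lia.
  by have := ltn_ord j; rewrite natz; lia.
have ltj : (j < n)%N by have := ltn_ord j'; lia.
rewrite (@hfm_of_mx_step A i j' (Ordinal ltj)) //.
have ilt : (i <= n)%N by have := ltn_ord i; lia.
by have := asm_row_prefix (Ordinal ltj) cA ilt; lia.
Qed.

Lemma hfm_of_mx_hfm A : is_asm A -> is_hfm (hfm_of_mx A).
Proof.
move=> hA; rewrite /is_hfm hfm_of_mx_tr !hfm_of_mx_rows //.
by rewrite /is_asm trmxK andbC.
Qed.

Let lo : 'I_n -> 'I_n.+1 := widen_ord (leqnSn n).
Let hi : 'I_n -> 'I_n.+1 := lift ord0.

Lemma asm_of_mx_prefix H (l : 'I_n) (i : 'I_n.+1) : is_hfm H ->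
  2 * row_prefix (asm_of_mx H)^T l i = 1 - (H i (hi l) - H i (lo l)).
Proof.
move=> /andP[/hfm_rowsP[r0 _ st] _].
have stl i' : `|H i' (hi l) - H i' (lo l)| = 1 by apply: st.
case: i => i; elim: i => [|i IHi] lti.
  rewrite row_prefix0 (_ : Ordinal lti = ord0) ?r0 /=; last exact: val_inj.
  by rewrite /bump /=; lia.
have lti' : (i < n)%N by [].
rewrite /= (row_prefixS _ l (Ordinal lti')) mulrDr.
rewrite (IHi (ltnW lti)) !mxE -/lo -/hi.
have -> : lo (Ordinal lti') = Ordinal (ltnW lti) by apply: val_inj.
have -> : hi (Ordinal lti') = Ordinal lti by apply: val_inj.
have := stl (Ordinal lti); have := stl (Ordinal (ltnW lti)).
lia.
Qed.

Lemma asm_of_mx_rows H : is_hfm H -> asm_rows (asm_of_mx H)^T.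
Proof.
move=> hH; have pre l i := asm_of_mx_prefix l i hH.
case/andP: hH => /hfm_rowsP[_ rn st] _.
apply: asm_rows_of_prefix => [l m lem|l].
  have := pre l (Ordinal (lem : (m < n.+1)%N)) => /=.
  by have := st (Ordinal (lem : (m < n.+1)%N)) (lo l) (hi l) erefl; lia.
by have := pre l ord_max; rewrite !rn /= /bump /=; lia.
Qed.

Lemma asm_of_mx_asm H : is_hfm H -> is_asm (asm_of_mx H).
Proof.
move=> hH; rewrite /is_asm asm_of_mx_rows // andbT -[asm_of_mx H]trmxK.
by rewrite asm_of_mx_tr asm_of_mx_rows // is_hfm_tr.
Qed.

Lemma asm_of_mxK H : is_hfm H -> hfm_of_mx (asm_of_mx H) = H.
Proof.
move=> hH; apply/matrixP=> i [j ltj]; have pre l := asm_of_mx_prefix l i hH.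
have hT : is_hfm H^T by rewrite is_hfm_tr.
elim: j ltj => [|j IHj] ltj.
  rewrite mxE exchange_big big_pred0 //= mulr0 (_ : Ordinal ltj = ord0); last exact: val_inj.
  by have /andP[/hfm_rowsP[+ _ _] _] := hT => /(_ i); rewrite mxE => ->; lia.
have ltj' : (j < n)%N by [].
have := @hfm_of_mx_step (asm_of_mx H) i (Ordinal ltj) (Ordinal ltj') (Ordinal (ltnW ltj)) erefl erefl.
rewrite IHj pre.
have -> : lo (Ordinal ltj') = Ordinal (ltnW ltj) by apply: val_inj.
have -> : hi (Ordinal ltj') = Ordinal ltj by apply: val_inj.
lia.
Qed.

Lemma hfm_of_mxK A : asm_of_mx (hfm_of_mx A) = A.
Proof.
apply/matrixP=> k l; rewrite mxE -/lo -/hi.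
have e i := @hfm_of_mx_step A i (hi l) l (lo l) erefl erefl.
have := row_prefixS A^T l k; rewrite mxE; have := e (lo k); have := e (hi k).
rewrite /= /bump /= add1n; lia.
Qed.

Definition hfm_of (A : ASM n) : HFM n := MkHFM (hfm_of_mx_hfm (valP A)).
Definition asm_of (H : HFM n) : ASM n := MkASM (asm_of_mx_asm (valP H)).

Lemma hfm_ofK : cancel hfm_of asm_of.
Proof. by move=> A; apply/val_inj/hfm_of_mxK. Qed.

Lemma asm_ofK : cancel asm_of hfm_of.
Proof. by move=> H; apply/val_inj/asm_of_mxK/valP. Qed.

Definition asm_le (A B : ASM n) : bool := (hfm_of A <= hfm_of B)%O.

Lemma asm_le_refl : reflexive asm_le.
Proof. by move=> A; apply: lexx. Qed.
Lemma asm_le_anti : antisymmetric asm_le.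
Proof. by move=> A B /le_anti /(can_inj hfm_ofK). Qed.
Lemma asm_le_trans : transitive asm_le.
Proof. by move=> A B C; apply: le_trans. Qed.

End Bijection.

Fact asm_display : Order.disp_t. Proof. exact: Order.Disp tt tt. Qed.
HB.instance Definition _ n := Order.Le_isPOrder.Build asm_display (ASM n)
  (@asm_le_refl n) (@asm_le_anti n) (@asm_le_trans n).

Fact hfm_of_mono n : {mono @hfm_of n : A B / (A <= B)%O}.
Proof. by []. Qed.

HB.instance Definition _ n := Order.IsoDistrLattice.Build asm_display (ASM n)
  (@hfm_ofK n) (@asm_ofK n) (@hfm_of_mono n).

Definition hfm_excedance n : rel (HFM n) := fun H H' =>
  [forall i : 'I_n.+1, forall j : 'I_n.+1,
     (j%:Z - i%:Z \in [:: 0; 1]) ==> (H i j == H' i j)].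

Definition asm_excedance n : rel (ASM n) := fun A B =>
  hfm_excedance (hfm_of A) (hfm_of B).

(* Main.v *)
Require Import Defs.
From mathcomp Require Import all_boot all_order all_algebra.

(** Joins and meets of HFMs are entrywise, so each of their entries depends only on the entries of
    the operands at that same position. Agreement on a fixed set of positions is thus preserved. For
    ASMs, pull back along the lattice isomorphism [hfm_of]. *)

Lemma hfm_excedanceP n (H K : HFM n) : reflect
  (forall i j : 'I_n.+1, (j%:Z - i%:Z)%R \in [:: 0%R; 1%R] -> H i j = K i j)
  (hfm_excedance H K).
Proof.
apply: (iffP forallP) => [h i j ij|h i].
  by have /forallP/(_ j)/implyP/(_ ij)/eqP := h i.
by apply/forallP=> j; apply/implyP=> ij; apply/eqP/h.
Qed.

Lemma hfm_joinE n (H K : HFM n) i j : (H `|` K)%O i j = Num.max (H i j) (K i j).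
Proof. exact: mxE. Qed.

Lemma hfm_meetE n (H K : HFM n) i j : (H `&` K)%O i j = Num.min (H i j) (K i j).
Proof. exact: mxE. Qed.

Lemma hfm_excedance_congruence n : lattice_congruence (@hfm_excedance n).
Proof.
split=> [x y z|x x' y y' /hfm_excedanceP xx' /hfm_excedanceP yy'].
  split=> [|/hfm_excedanceP xy]; first exact/hfm_excedanceP.
  (* [equivalence_rel] packs symmetry and transitivity into one boolean equality; the same rewriting
     proves both directions. *)
  by apply/hfm_excedanceP/hfm_excedanceP=> h i j ij; rewrite -h // xy.
by split; apply/hfm_excedanceP=> i j ij;
  rewrite ?hfm_joinE ?hfm_meetE xx' // yy'.
Qed.

(* Joins and meets of ASMs are defined by transport along hfm_of, so both lemmas
   reduce to asm_ofK. *)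
Lemma hfm_of_join n (A B : ASM n) : hfm_of (A `|` B)%O = (hfm_of A `|` hfm_of B)%O.
Proof. exact: asm_ofK. Qed.

Lemma hfm_of_meet n (A B : ASM n) : hfm_of (A `&` B)%O = (hfm_of A `&` hfm_of B)%O.
Proof. exact: asm_ofK. Qed.

Lemma asm_excedance_congruence n : lattice_congruence (@asm_excedance n).
Proof.
have [eqv cong] := hfm_excedance_congruence n.
(* [asm_excedance] unfolds to [hfm_excedance] on images, so [eqv] applies by conversion. *)
split=> [x y z|x x' y y' xx' yy']; first exact: eqv.
by rewrite /asm_excedance !hfm_of_join !hfm_of_meet; exact: cong.
Qed.

Theorem lemma3p5 (n : nat) (n_ge1 : (1 <= n)%N) :
  lattice_congruence (@hfm_excedance n) /\
  lattice_congruence (@asm_excedance n).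
Proof.
by split; [exact: hfm_excedance_congruence|exact: asm_excedance_congruence].
Qed.
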